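(* Let $G$ be a finite perfect graph without isolated vertices, let $\mathcal{C}=\mathrm{cl}(G)$ be its clique clutter, and let $v_1,\ldots,v_q\in\{0,1\}^n$ be the characteristic vectors of the edges of $\mathcal{C}$. Suppose that $\mathcal{C}$ is both ideal and uniform. Then: (a) $\{v_1,\ldots,v_q\}$ is a Hilbert basis. (b) $\mathcal{C}$ is Ehrhart. (c) $\mathcal{C}$ has the max-flow min-cut property.
   Context: A graph is perfect if every induced subgraph has chromatic number equal to its clique number. A clique is a set of mutually adjacent vertices. The clique clutter $\mathrm{cl}(G)$ is the clutter on the vertex set $V(G)=\{x_1,\ldots,x_n\}$ whose edges are the inclusion-maximal cliques of $G$ (a clutter being a family of subsets, called edges, none containing another). A clutter is uniform if all its edges have the same cardinality. The characteristic vector of an edge $e$ is $\sum_{x_i\in e}e_i\in\{0,1\}^n$ with $e_i$ the $i$-th unit vector, and the clutter matrix $A$ has these vectors as columns. A clutter is ideal if the polyhedron $Q(A)=\{x\mid x\ge0;\ xA\ge\mathbf{1}\}$ has only integral vertices, where $\mathbf{1}$ is the all-ones vector. It has the max-flow min-cut property (is MFMC) if the linear program $\max\{\langle\mathbf{1},y\rangle\mid y\ge0,\ Ay\le w\}$ has an integral optimal solution for every $w\in\mathbb{N}^n$, $\mathbb{N}=\{0,1,2,\ldots\}$. A finite set $\mathcal{H}\subset\mathbb{Z}^m$ is a Hilbert basis if $\mathbb{N}\mathcal{H}=\mathbb{R}_+\mathcal{H}\cap\mathbb{Z}^m$, where $\mathbb{N}\mathcal{H}$ and $\mathbb{R}_+\mathcal{H}$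 are the non-negative integer span and non-negative real span of $\mathcal{H}$. A clutter with characteristic vectors $v_1,\ldots,v_q$ is Ehrhart if $\{(v_1,1),\ldots,(v_q,1)\}\subset\{0,1\}^{n+1}$ is a Hilbert basis. *)

(* Defs.v *)
From HB Require Import structures.
From mathcomp Require Import all_boot all_order all_algebra.
From mathcomp Require Import reals.

Set Implicit Arguments.
Unset Strict Implicit.
Unset Printing Implicit Defensive.

Import Order.TTheory GRing.Theory Num.Theory.
Local Open Scope ring_scope.

Record sgraph (T : finType) := SGraph {
  adj :> rel T;
  adj_sym : symmetric adj;
  adj_irr : irreflexive adj
}.

Definition no_isolated (T : finType) (G : sgraph T) : Prop :=
  forall x, exists y, G x y.

Definition clique (T : finType) (G : sgraph T) (K : {set T}) : bool :=
  [forall x in K, forall y in K, (x != y) ==> G x y].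

Definition clique_number (T : finType) (G : sgraph T) : nat :=
  \max_(K : {set T} | clique G K) #|K|.

Definition colorable (T : finType) (G : sgraph T) (k : nat) : bool :=
  [exists c : {ffun T -> 'I_k}, forall x, forall y, G x y ==> (c x != c y)].

Lemma ex_colorable (T : finType) (G : sgraph T) : exists k, colorable G k.
Proof.
exists #|T|; apply/existsP; exists [ffun x => enum_rank x].
apply/forallP => x; apply/forallP => y; apply/implyP => Gxy; rewrite !ffunE.
by apply: contraTneq Gxy => /enum_rank_inj ->; rewrite adj_irr.
Qed.

Definition chromatic_number (T : finType) (G : sgraph T) : nat :=
  ex_minn (ex_colorable G).

Section Induced.
Variables (T : finType) (G : sgraph T) (S : {set T}).

Definition induced_adj : rel {x : T | x \in S} :=
  [rel x y | G (val x) (val y)].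

Lemma induced_adj_sym : symmetric induced_adj.
Proof. by move=> x y; exact: adj_sym. Qed.

Lemma induced_adj_irr : irreflexive induced_adj.
Proof. by move=> x; exact: adj_irr. Qed.

Definition induced : sgraph {x : T | x \in S} :=
  SGraph induced_adj_sym induced_adj_irr.

End Induced.

Definition perfect (T : finType) (G : sgraph T) : Prop :=
  forall S : {set T},
    chromatic_number (induced G S) = clique_number (induced G S).

Record clutter (T : finType) := Clutter {
  edges :> {set {set T}};
  edges_incomparable :
    forall e f, e \in edges -> f \in edges -> e \subset f -> e = f
}.

Definition uniform (T : finType) (C : clutter T) : Prop :=
  forall e f, e \in edges C -> f \in edges C -> #|e| = #|f|.

Definition max_cliques (T : finType) (G : sgraph T) : {set {set T}} :=
  [set K | maxset (clique G) K].

Lemma max_cliques_incomparable (T : finType) (G : sgraph T) e f :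
  e \in max_cliques G -> f \in max_cliques G -> e \subset f -> e = f.
Proof.
rewrite !inE => /maxsetP[_ e_max] /maxsetP[f_clique _] sef.
by rewrite (e_max f).
Qed.

Definition clique_clutter (T : finType) (G : sgraph T) : clutter T :=
  Clutter (@max_cliques_incomparable T G).

Definition char_vec (R : nzRingType) (n : nat) (e : {set 'I_n}) : 'cV[R]_n :=
  \col_i (i \in e)%:R.

Definition edge_vec (n : nat) (C : clutter 'I_n) (j : 'I_#|C|) : 'cV[int]_n :=
  char_vec int (enum_val j).

Definition clutter_matrix (R : nzRingType) (n : nat) (C : clutter 'I_n) :
    'M[R]_(n, #|C|) :=
  \matrix_(i, j) char_vec R (enum_val j) i 0.

(* {x} is the intersection of P with a supporting hyperplane of P, that is,
   {x} is a face of P. *)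
Definition vertex (R : realType) (n : nat) (P : 'rV[R]_n -> Prop)
    (x : 'rV[R]_n) : Prop :=
  exists (c : 'cV[R]_n) (delta : R),
    (forall y, P y -> delta <= (y *m c) 0 0) /\
    (forall y, P y /\ (y *m c) 0 0 = delta <-> y = x).

Definition covering_polyhedron (R : realType) (n q : nat) (A : 'M[R]_(n, q))
    (x : 'rV[R]_n) : Prop :=
  (forall i, 0 <= x 0 i) /\ (forall j, 1 <= (x *m A) 0 j).

Definition ideal (R : realType) (n : nat) (C : clutter 'I_n) : Prop :=
  forall x : 'rV[R]_n,
    vertex (covering_polyhedron (clutter_matrix R C)) x ->
    forall i, x 0 i \is a Num.int.

Definition packing (R : realType) (n q : nat) (A : 'M[R]_(n, q))
    (w : 'cV[nat]_n) (y : 'cV[R]_q) : Prop :=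
  (forall j, 0 <= y j 0) /\ (forall i, (A *m y) i 0 <= (w i 0)%:R).

Definition mfmc (R : realType) (n : nat) (C : clutter 'I_n) : Prop :=
  forall w : 'cV[nat]_n, exists y : 'cV[R]_#|C|,
    [/\ packing (clutter_matrix R C) w y,
        forall j, y j 0 \is a Num.int &
        forall y', packing (clutter_matrix R C) w y' ->
          \sum_j y' j 0 <= \sum_j y j 0].

(* A finite set of integer vectors is given by an enumeration h, possibly with
   repetitions; the two spans only depend on the range of h. *)
Definition nat_span (m q : nat) (h : 'I_q -> 'cV[int]_m) (z : 'cV[int]_m) :
    Prop :=
  exists c : 'I_q -> nat, z = \sum_j h j *+ c j.

Definition real_cone (R : realType) (m q : nat) (h : 'I_q -> 'cV[int]_m)
    (x : 'cV[R]_m) : Prop :=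
  exists c : 'I_q -> R,
    (forall j, 0 <= c j) /\ x = \sum_j c j *: map_mx intr (h j).

Definition hilbert_basis (R : realType) (m q : nat) (h : 'I_q -> 'cV[int]_m) :
    Prop :=
  forall z : 'cV[int]_m,
    nat_span h z <-> real_cone h (map_mx (intr : int -> R) z).

Definition ehrhart (R : realType) (n : nat) (C : clutter 'I_n) : Prop :=
  hilbert_basis R (fun j : 'I_#|C| => col_mx (edge_vec j) (1%:M : 'cV[int]_1)).

(* Main.v *)
From HB Require Import structures.
Require Import Defs.
From mathcomp Require Import all_boot all_order all_algebra.
From mathcomp Require Import reals.

(** Let [d] be the common size of the edges, so that the coordinates of a
    combination [\sum_j y j v_j] add up to [d * \sum_j y j]. Counting
    with this equality shows that fractional covers are exact.

    Hilbert basis. Perfection provides colourings for all vertex weights, by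
    Lovasz's replication argument ([perfect_weighted_colouring]): if every
    clique has weight at most [N], then at most [N] stable sets cover each vertex
    as often as its weight. By the Farkas lemma over the rationals, a weight [z] for which
    no stable set exceeds [k] is then dominated by a fractional family of edges
    of total mass at most [k] ([fractional_clique_cover]). If moreover
    [d * k <= \sum_i z i], counting makes this family cover [z] exactly and have
    total mass [k]; by complementary slackness an edge of positive mass meets
    every stable set of weight [k], so subtracting it from [z] allows an
    induction on [k] ([integral_decomposition]). An integral point
    [z = \sum_j y j v_j] of the cone satisfies the hypotheses when [k] is the
    largest weight of a stable set, since an edge meets a stable set at most
    once and hence [k <= \sum_j y j] ([cone_decomposition]).

    Ehrhart. The last coordinate of a point over [z] is [\sum_j y j], which is
    determined by [z] through [d * \sum_j y j = \sum_i z i].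

    Max-flow min-cut. Let [k] be the least [w]-weight of a vertex cover. Lower
    [w], one unit at a time, as long as all vertex covers keep weight at least
    [k]. Since the clutter is ideal, a fractional packing of value [k] exists
    ([ideal_fractional_packing]); at the end of the process each vertex of
    positive weight lies on a vertex cover of weight exactly [k], so that the
    packing saturates it. Hence the lowered [w] lies in the cone of the edges,
    and the Hilbert basis property turns the packing into an integral one
    ([integral_packing]). *)

Set Implicit Arguments.
Unset Strict Implicit.
Unset Printing Implicit Defensive.

Import Order.TTheory GRing.Theory Num.Theory.

(** * Weighted colourings of perfect graphs *)

Definition stable (T : finType) (G : sgraph T) (S : {set T}) : bool :=
  [forall x in S, forall y in S, ~~ G x y].

Lemma cliqueP (T : finType) (G : sgraph T) (K : {set T}) :
  reflect {in K &, forall x y, x != y -> G x y} (clique G K).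
Proof.
apply: (iffP forall_inP) => [KG x y xK yK|KG x xK].
  by move/forall_inP: (KG x xK) => /(_ y yK)/implyP.
by apply/forall_inP => y yK; apply/implyP; exact: KG.
Qed.

Lemma stableP (T : finType) (G : sgraph T) (S : {set T}) :
  reflect {in S &, forall x y, ~~ G x y} (stable G S).
Proof.
apply: (iffP forall_inP) => [SG x y xS yS|SG x xS].
  by move/forall_inP: (SG x xS) => /(_ y yS).
by apply/forall_inP => y yS; exact: SG.
Qed.

Lemma card_clique_stable (T : finType) (G : sgraph T) (K S : {set T}) :
  clique G K -> stable G S -> #|K :&: S| <= 1.
Proof.
move=> /cliqueP KG /stableP SG; apply/card_le1_eqP => x y.
rewrite !inE => /andP[xK xS] /andP[yK yS].
by apply: contraNeq (SG x y xS yS) => yx; rewrite adj_sym KG.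
Qed.

Lemma stable1 (T : finType) (G : sgraph T) x : stable G [set x].
Proof. by apply/stableP => y z /set1P-> /set1P->; rewrite adj_irr. Qed.

(** For 0/1 weights, this is perfection of the subgraph induced by the
    support [S]. *)
Lemma perfect_colouring01 (T : finType) (G : sgraph T) (S : {set T}) (N : nat) :
  perfect G ->
  (forall K, clique G K -> K \subset S -> #|K| <= N) ->
  exists s : seq {set T}, [/\ size s <= N, all (stable G) s &
    forall x, count (fun A : {set T} => x \in A) s = (x \in S)].
Proof.
move=> G_perf clique_le.
have : chromatic_number (induced G S) <= N.
  rewrite G_perf; apply/bigmax_leqP => K /cliqueP Kc.
  rewrite -(card_imset _ val_inj); apply: clique_le.
    apply/cliqueP => _ _ /imsetP[x xK ->] /imsetP[y yK ->] xy.
    exact: Kc.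
  by apply/subsetP => _ /imsetP[x _ ->]; exact: valP.
rewrite /chromatic_number; case: ex_minnP => k.
move=> /existsP[c /forallP c_proper] _ kN.
pose col (i : 'I_k) : {set T} := [set val x | x in [set x | c x == i]].
exists [seq col i | i <- enum 'I_k]; split.
- by rewrite size_map size_enum_ord.
- apply/allP => _ /mapP[i _ ->]; apply/stableP.
  move=> _ _ /imsetP[x xi ->] /imsetP[y yi ->].
  move: xi yi; rewrite !inE => /eqP xi /eqP yi.
  by move/forallP: (c_proper x) => /(_ y); rewrite xi yi eqxx implybF.
- move=> x; rewrite count_map.
  have [xS|xS] := boolP (x \in S).
    rewrite (@eq_count _ _ (pred1 (c (Sub x xS)))).
      by rewrite count_uniq_mem ?enum_uniq // mem_enum.
    move=> i /=; apply/imsetP/eqP => [[y]|->].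
      by rewrite inE => /eqP <- xy; congr (c _); apply/val_inj.
    by exists (Sub x xS); rewrite ?inE.
  rewrite (@eq_count _ _ pred0) ?count_pred0 // => i /=.
  by apply/negP => /imsetP[y _ xy]; move: xS; rewrite xy (valP y).
Qed.

Lemma sum_count_mem (T : finType) (K : {set T}) (s : seq {set T}) :
  \sum_(x in K) count (fun A : {set T} => x \in A) s = \sum_(A <- s) #|K :&: A|.
Proof.
elim: s => [|A s IHs]; first by rewrite big_nil big1.
rewrite big_cons -IHs /= big_split /=; congr (_ + _).
rewrite -sum1_card [RHS](eq_bigl (fun x => (x \in K) && (x \in A))).
  by rewrite big_mkcondr; apply: eq_bigr => x _; case: (x \in A).
by move=> x; rewrite inE.
Qed.

(** Lovasz's replication lemma, with multiplicities of vertices in place of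
    copies. If [1 < m v], colour the weights [m'] with [v] lowered by one, and
    take a colour class [A] through [v]. A clique of [m']-weight [N] avoids [v],
    since its [m]-weight is at most [N], and it meets each of the at most [N]
    classes; so it meets [A :\ v]. Lowering the weight on [A :\ v] thus leaves
    all cliques below [N], and [A] can be added back as one more class, which
    also restores the missing unit at [v]. *)
Lemma perfect_weighted_colouring (T : finType) (G : sgraph T) (m : T -> nat)
    (N : nat) :
  perfect G ->
  (forall K, clique G K -> \sum_(x in K) m x <= N) ->
  exists s : seq {set T}, [/\ size s <= N, all (stable G) s &
    forall x, count (fun A : {set T} => x \in A) s = m x].
Proof.
move=> G_perf.
move: {2}(\sum_x m x).+1 (ltnSn (\sum_x m x)) => k.
elim: k => // k IHk in m N * => lt_m clique_le.
have [v mv|m_le1] := pickP (fun v => 1 < m v); last first.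
  have [|s [sN s_stable sP]] :=
      @perfect_colouring01 _ G [set x | 0 < m x] N G_perf.
    move=> K Kc /subsetP KS; apply: leq_trans (clique_le K Kc).
    by rewrite -sum1_card; apply: leq_sum => x /KS; rewrite inE.
  exists s; split=> // x; rewrite sP inE.
  by have := m_le1 x; case: (m x) => [|[]].
pose m' x := m x - (x == v).
have m'E x : m x = (m' x + (x == v))%N.
  by rewrite subnK //; case: eqP => // ->; exact: ltnW.
have sum_m' : \sum_x m x = (\sum_x m' x).+1.
  rewrite (eq_bigr _ (fun x _ => m'E x)) big_split /= -addn1; congr addn.
  by rewrite (bigD1 v) //= eqxx big1 // => x /negPf->.
have m'_clique K : clique G K -> \sum_(x in K) m' x <= N.
  by move=> /clique_le; apply: leq_trans; apply: leq_sum => x _; exact: leq_subr.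
have [|s [sN s_stable sP]] := IHk m' N _ m'_clique.
  by rewrite -ltnS -sum_m'.
have [A As vA] : exists2 A, A \in s & v \in A.
  by apply/hasP; rewrite has_count sP /m' eqxx subn_gt0.
pose m'' x := m' x - (x \in A :\ v).
have m''E x : m' x = (m'' x + (x \in A :\ v))%N.
  rewrite subnK // -sP; case: (boolP (x \in _ :\ _)) => //.
  rewrite inE => /andP[_ xA].
  by rewrite -has_count; apply/hasP; exists A.
have N_gt0 : 0 < N.
  by apply: leq_trans sN; rewrite -has_predT; apply/hasP; exists A.
have [||t [tN t_stable tP]] := IHk m'' N.-1.
- rewrite (leq_ltn_trans _ (_ : \sum_x m' x < k)) -?sum_m' //.
  by apply: leq_sum => x _; exact: leq_subr.
- move=> K Kc; rewrite -ltnS prednK // ltn_neqAle.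
  have le_m'' : \sum_(x in K) m'' x <= \sum_(x in K) m' x.
    by apply: leq_sum => x _; exact: leq_subr.
  rewrite (leq_trans le_m'' (m'_clique K Kc)) andbT.
  apply/eqP => m''K.
  have m'K : \sum_(x in K) m' x = N.
    by apply/eqP; rewrite eqn_leq m'_clique // -m''K.
  have vK : v \notin K.
    apply: contra_eqN m'K => vK; rewrite ltn_eqF //.
    apply: leq_trans (clique_le K Kc).
    rewrite (eq_bigr _ (fun x _ => m'E x)) big_split /= -addn1 leq_add2l.
    by rewrite (bigD1 v) //= eqxx.
  have KA1 : 0 < #|K :&: A|.
    rewrite lt0n; apply: contra_eqN m'K => /eqP KA0; rewrite ltn_eqF //.
    rewrite -(eq_bigr _ (fun x _ => sP x)) sum_count_mem.
    apply: leq_trans sN; rewrite (big_rem A) //= KA0 add0n.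
    rewrite (perm_size (perm_to_rem As)) /=.
    rewrite ltnS -sum1_size big_seq [leqRHS]big_seq; apply: leq_sum => B.
    by move=> /mem_rem/(allP s_stable)/(card_clique_stable Kc).
  move: m''K; rewrite -m'K (eq_bigr _ (fun x _ => m''E x)) big_split /=.
  move/eqP; rewrite -[X in X == _]addn0 eqn_add2l eq_sym sum_nat_eq0.
  move/forall_inP; case/card_gt0P: KA1 => x; rewrite inE => /andP[xK xA].
  move=> /(_ x xK); rewrite !inE xA andbT eqb0 negbK => /eqP xv.
  by move: vK; rewrite -xv xK.
exists (A :: t); split.
- by rewrite /= -(prednK N_gt0).
- by rewrite /= (allP s_stable).
- move=> x; rewrite /= tP m'E m''E !inE.
  by have [->|xv] := eqVneq x v; rewrite ?vA /= ?addn0 1?addnC.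
Qed.

Local Open Scope ring_scope.

(** * Linear inequalities over an ordered field *)

(** Induction on the number of rows. A solution [x0] for the remaining rows
    that violates the first row [a] is scaled to [a *m x0 = 1]; projecting along
    [x0] onto the kernel of [a] eliminates the first row, and the multiplier of
    [a] recovered from the projected system is nonnegative because [x0]
    separates [g] from the remaining rows. *)
Lemma farkas (F : realFieldType) (m n : nat) (A : 'M[F]_(m, n))
    (g : 'rV[F]_n) :
  (exists2 l : 'rV[F]_m, forall i, 0 <= l 0 i & g = l *m A) \/
  (exists2 x : 'cV[F]_n, forall i, (A *m x) i 0 <= 0 & 0 < (g *m x) 0 0).
Proof.
elim: m => [|m IHm] in A g *.
  have [->|g_neq0] := eqVneq g 0.
    by left; exists 0 => [[]//|]; rewrite mul0mx.
  right; exists g^T => [[]//|]; rewrite mxE.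
  have [i gi_neq0] : exists i, g 0 i != 0.
    apply/existsP; apply: contraNT g_neq0 => /existsPn g0.
    by apply/eqP/rowP => i; rewrite mxE; apply/eqP; rewrite -[_ == _]negbK.
  rewrite (bigD1 i) //= ltr_pwDl //.
    by rewrite mxE -expr2 lt_def sqrf_eq0 gi_neq0 sqr_ge0.
  by apply: sumr_ge0 => j _; rewrite mxE -expr2 sqr_ge0.
move: A; rewrite -[m.+1]/(1 + m)%N => A.
rewrite -[A]vsubmxK; move: (usubmx A) (dsubmx A) => a {}A.
have [[l l_ge0 ->]|[x0 Ax0 gx0]] := IHm A g.
  left; exists (row_mx 0 l); last by rewrite mul_row_col mul0mx add0r.
  move=> i; rewrite mxE; case: (split i) => j //; by rewrite mxE.
have [ax0|ax0] := lerP ((a *m x0) 0 0) 0.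
  right; exists x0 => // i; rewrite mul_col_mx mxE.
  by case: (split i) => j //; rewrite ord1.
wlog ax1 : x0 Ax0 gx0 {ax0} / a *m x0 = 1%:M.
  move=> /(_ (((a *m x0) 0 0)^-1 *: x0)); apply.
  - by move=> i; rewrite -scalemxAr mxE pmulr_rle0 ?invr_gt0.
  - by rewrite -scalemxAr mxE pmulr_rgt0 ?invr_gt0.
  - rewrite -scalemxAr {2}[a *m x0]mx11_scalar scale_scalar_mx mulVf //.
    by rewrite gt_eqF.
have [[l l_ge0 lP]|[x Ax gx]] := IHm (A - A *m x0 *m a) (g - g *m x0 *m a).
  left; exists (row_mx (g *m x0 - l *m A *m x0) l).
    move=> i; rewrite mxE; case: (split i) => j //.
    rewrite ord1 mxE [X in _ + X]mxE subr_ge0 -mulmxA.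
    apply: le_trans (ltW gx0); rewrite mxE.
    by apply: sumr_le0 => k _; rewrite mulr_ge0_le0.
  rewrite mul_row_col -[LHS](subrK (g *m x0 *m a)) lP mulmxBr mulmxBl !mulmxA.
  by rewrite addrC -[RHS]addrA; congr (_ + _); exact: addrC.
right; exists (x - x0 *m (a *m x)).
  move=> i; rewrite mul_col_mx mxE; case: (split i) => j.
    by rewrite mulmxBr (mulmxA a x0) ax1 mul1mx subrr mxE.
  by rewrite mulmxBr !mulmxA -mulmxBl.
by rewrite mulmxBr !mulmxA -mulmxBl.
Qed.

(** Slack variables, that is, the additional rows [1%:M], turn the
    inequalities into equalities and force the certificate [x] to have a
    constant sign. *)
Lemma farkas_ineq (F : realFieldType) (I J : finType) (M : I -> J -> F)
    (b : I -> F) :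
  (exists2 y : J -> F, forall j, 0 <= y j &
     forall i, \sum_j M i j * y j <= b i) \/
  (exists x : I -> F, [/\ forall i, 0 <= x i,
     forall j, 0 <= \sum_i x i * M i j & \sum_i x i * b i < 0]).
Proof.
pose A : 'M[F]_(#|J|, #|I|) := \matrix_(j, i) M (enum_val i) (enum_val j).
pose g : 'rV[F]_#|I| := \row_i b (enum_val i).
have [[l l_ge0 lP]|[x xA gx]] := farkas (col_mx A 1%:M) g.
  left; exists (fun j => l 0 (lshift #|I| (enum_rank j))) => // i.
  rewrite -[l]hsubmxK mul_row_col mulmx1 in lP.
  move/rowP/(_ (enum_rank i)): lP; rewrite !mxE enum_rankK => ->.
  rewrite (reindex _ (onW_bij _ (enum_val_bij _))) /= -[leLHS]addr0 lerD //.
  by apply: ler_sum => j _; rewrite !mxE enum_rankK enum_valK mulrC.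
right; exists (fun i => - x (enum_rank i) 0); split.
- move=> i; have := xA (rshift #|J| (enum_rank i)).
  by rewrite mul_col_mx mul1mx col_mxEd oppr_ge0.
- move=> j; have := xA (lshift #|I| (enum_rank j)).
  rewrite mul_col_mx col_mxEu mxE -oppr_ge0 -sumrN.
  rewrite [X in _ -> 0 <= X](reindex _ (onW_bij _ (enum_val_bij _))) /=.
  congr (0 <= _); apply: eq_bigr => i _.
  by rewrite mxE enum_rankK enum_valK mulNr mulrC.
- rewrite mxE -oppr_lt0 -sumrN in gx.
  rewrite (reindex _ (onW_bij _ (enum_val_bij _))) /=.
  congr (_ < 0): gx; apply: eq_bigr => i _.
  by rewrite mxE enum_valK mulNr mulrC.
Qed.

(** * Vertices of polyhedra *)

Lemma vertex_ext (R : realType) (n : nat) (P Q : 'rV[R]_n -> Prop)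
    (x : 'rV[R]_n) :
  (forall y, P y <-> Q y) -> vertex P x -> vertex Q x.
Proof.
move=> PQ [c [delta [c_min c_face]]]; exists c, delta; split.
  by move=> y /PQ/c_min.
move=> y; split; last by move=> /c_face[/PQ].
by case=> /PQ Py yc; apply/c_face.
Qed.

Section Polyhedron.
Variables (R : realType) (n m : nat) (B : 'M[R]_(n, m)) (b : 'rV[R]_m).

Definition polyhedron (x : 'rV[R]_n) : Prop :=
  forall j, b 0 j <= (x *m B) 0 j.

Definition tight (x : 'rV[R]_n) : {set 'I_m} :=
  [set j | (x *m B) 0 j == b 0 j].

(** The sum of the tight inequalities is a supporting hyperplane: equality in
    the sum means equality in each of them, which determines the point. *)
Lemma vertex_of_tight (x : 'rV[R]_n) :
  polyhedron x ->
  (forall h : 'rV[R]_n, (forall j, j \in tight x -> (h *m B) 0 j = 0) ->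
    h = 0) ->
  vertex polyhedron x.
Proof.
move=> xP tight_full.
pose t : 'cV[R]_m := \col_j (j \in tight x)%:R.
have tE (y : 'rV[R]_m) : (y *m t) 0 0 = \sum_(j in tight x) y 0 j.
  rewrite mxE [RHS]big_mkcond; apply: eq_bigr => j _; rewrite mxE.
  by case: ifP; rewrite ?mulr1 ?mulr0.
exists (B *m t), ((b *m t) 0 0); split=> [y yP|y].
  by rewrite mulmxA !tE; apply: ler_sum.
split=> [[yP]|->]; last first.
  split=> //; rewrite mulmxA !tE; apply: eq_bigr => j.
  by rewrite inE => /eqP.
rewrite mulmxA !tE => /eqP; rewrite eq_sym => /eqP yt.
apply/eqP; rewrite -subr_eq0; apply/eqP/tight_full => j jt.
have /leif_sum[_] : forall i, i \in tight x ->
    b 0 i <= (y *m B) 0 i ?= iff (b 0 i == (y *m B) 0 i).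
  by move=> i _; split.
rewrite yt eqxx => /esym/forall_inP/(_ j jt)/eqP yj.
move: jt; rewrite inE => /eqP xj.
by rewrite mulmxBl mxE [X in _ + X]mxE -yj xj subrr.
Qed.

(** As long as the tight inequalities do not determine the point, there is a
    line along which they stay tight. Moving along it in the direction in which
    [c] does not increase, up to the first inequality that becomes tight,
    enlarges the set of tight inequalities. Injectivity of [B] rules out lines
    inside the polyhedron, and the second hypothesis, that [c] is nonnegative on
    the recession cone, rules out moving forever while [c] decreases. *)
Lemma exists_vertex_le (c : 'cV[R]_n) (x : 'rV[R]_n) :
  row_free B ->
  (forall h : 'rV[R]_n, (forall j, 0 <= (h *m B) 0 j) -> 0 <= (h *m c) 0 0) ->
  polyhedron x ->
  exists2 v, vertex polyhedron v & polyhedron v /\ (v *m c) 0 0 <= (x *m c) 0 0.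
Proof.
move=> B_free c_bounded.
move: {2}#|~: tight x|.+1 (ltnSn #|~: tight x|) => k.
elim: k => // k IHk in x * => lt_tight xP.
(* [B] with the columns of the inequalities that are not tight at [x] zeroed. *)
pose D : 'M[R]_(n, m) := \matrix_(i, j) (B i j *+ (j \in tight x)).
have DE (h : 'rV[R]_n) j : (h *m D) 0 j = (h *m B) 0 j *+ (j \in tight x).
  rewrite !mxE -sumrMnl; apply: eq_bigr => i _; by rewrite mxE mulrnAr.
have [D_free|] := boolP (row_free D).
  exists x => //; apply: vertex_of_tight => // h h0.
  apply: (row_free_inj D_free); rewrite mul0mx; apply/rowP => j.
  by rewrite DE [RHS]mxE; case: (boolP (j \in _)) => [/h0 ->|//]; rewrite mul0rn.
rewrite -kermx_eq0 => /rowV0Pn[h0 /sub_kermxP h0D h0_neq0].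
have {h0 h0D h0_neq0} [h [hD hc [j0 hj0]]] : exists h : 'rV[R]_n,
    [/\ h *m D = 0, (h *m c) 0 0 <= 0 & exists j, (h *m B) 0 j < 0].
  wlog h0c : h0 h0D h0_neq0 / (h0 *m c) 0 0 <= 0.
    move=> wlog_h0; have [|lt0] := leP ((h0 *m c) 0 0) 0.
      exact: wlog_h0.
    apply: (wlog_h0 (- h0)); rewrite ?mulNmx ?h0D ?oppr0 ?oppr_eq0 //.
    by rewrite mxE oppr_le0 ltW.
  have [j hj|neg] := pickP (fun j => (h0 *m B) 0 j < 0).
    by exists h0; split=> //; exists j.
  have h0B j : 0 <= (h0 *m B) 0 j by rewrite leNgt neg.
  have h0c0 : (h0 *m c) 0 0 = 0 by apply/le_anti; rewrite h0c c_bounded.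
  have [j hj] : exists j, (h0 *m B) 0 j != 0.
    apply/existsP; apply: contraNT h0_neq0 => /existsPn hB0.
    apply/eqP/(row_free_inj B_free); rewrite mul0mx; apply/rowP => j.
    by rewrite [RHS]mxE; apply/eqP; have := hB0 j; rewrite negbK.
  exists (- h0); split.
  - by rewrite mulNmx h0D oppr0.
  - by rewrite mulNmx mxE h0c0 oppr0.
  - by exists j; rewrite mulNmx mxE oppr_lt0 lt_def hj h0B.
(* The step length at which inequality [j] becomes tight. *)
pose r j := ((x *m B) 0 j - b 0 j) / - (h *m B) 0 j.
have [j hj j_min] := @arg_minP _ _ _ j0 (fun j => (h *m B) 0 j < 0) r hj0.
have stepE i : ((x + r j *: h) *m B) 0 i = (x *m B) 0 i + r j * (h *m B) 0 i.
  by rewrite mulmxDl -scalemxAl mxE [X in _ + X]mxE.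
have r_ge0 : 0 <= r j.
  by rewrite divr_ge0 ?subr_ge0 // oppr_ge0 ltW.
have [||v v_vertex [vP vc]] := IHk (x + r j *: h).
- apply: leq_trans (_ : #|~: tight x| <= k)%N => //.
  apply/proper_card/properP; split; last exists j.
  + rewrite setCS; apply/subsetP => i it; rewrite inE stepE.
    move/rowP/(_ i): hD; rewrite DE it mulr1n [RHS]mxE => ->.
    by rewrite mulr0 addr0; move: it; rewrite inE.
  + rewrite inE; apply: contraTN hj => jt; rewrite -leNgt.
    by move/rowP/(_ j): hD; rewrite DE jt mulr1n [RHS]mxE => ->.
  + rewrite !inE negbK stepE /r invrN mulrN mulNr mulfVK ?(lt_eqF hj) //.
    by rewrite opprB addrC subrK.
- move=> i; rewrite stepE.
  have [hi|hi] := lerP 0 ((h *m B) 0 i).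
    by rewrite (le_trans (xP i)) // lerDl mulr_ge0.
  have := j_min i hi; rewrite [X in _ <= X]/r ler_pdivlMr ?oppr_gt0 //.
  by rewrite mulrN lerBrDr addrC -lerBrDr opprK addrC.
exists v => //; split=> //; apply: le_trans vc _.
by rewrite mulmxDl -scalemxAl mxE gerDl mxE mulr_ge0_le0.
Qed.

End Polyhedron.

(** * Covering and decomposing vertex weights by cliques *)

Lemma sum_incidence (V : nmodType) (T J : finType) (e : J -> {set T})
    (y : J -> V) (S : {set T}) :
  \sum_(i in S) \sum_(j | i \in e j) y j = \sum_j y j *+ #|e j :&: S|.
Proof.
rewrite (exchange_big_dep predT) //=; apply: eq_bigr => j _.
rewrite -sumr_const; apply: eq_bigl => i; by rewrite inE andbC.
Qed.

Lemma clear_denominators (I : finType) (x : I -> rat) :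
  (forall i, 0 <= x i) ->
  exists (N : nat) (m : I -> nat), (0 < N)%N /\ forall i, (m i)%:R = N%:R * x i.
Proof.
move=> x_ge0; pose d i := `|denq (x i)|%N.
have dE i : (d i)%:R = (denq (x i))%:~R :> rat.
  by rewrite natr_absz gtr0_norm ?denq_gt0.
exists (\prod_i d i)%N, (fun i => `|numq (x i)| * \prod_(j | j != i) d j)%N.
split=> [|i]; first by apply: prodn_gt0 => i; rewrite absz_gt0 denq_neq0.
rewrite [in RHS](bigD1 i) //= !natrM dE mulrAC; congr (_ * _).
by rewrite mulrC -numqE natr_absz ger0_norm ?numq_ge0.
Qed.

(** If no such [y] exists, a Farkas certificate over the rationals becomes,
    after clearing denominators, vertex weights [m] and a bound [N] such that no
    clique has weight more than [N] while [\sum_i m i * z i > N * k]. But [m] is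
    a sum of at most [N] stable sets, each of [z]-weight at most [k]. *)
Lemma fractional_clique_cover (T J : finType) (G : sgraph T)
    (e : J -> {set T}) (z : T -> nat) (k : nat) :
  perfect G ->
  (forall K, clique G K -> exists j, K \subset e j) ->
  (forall S, stable G S -> \sum_(i in S) z i <= k)%N ->
  exists y : J -> rat, [/\ forall j, 0 <= y j,
    forall i, (z i)%:R <= \sum_(j | i \in e j) y j & \sum_j y j <= k%:R].
Proof.
move=> G_perf e_max z_stable.
(* The summand ['I_1] indexes the bound on the total mass. *)
pose M (i : 'I_1 + T) (j : J) : rat :=
  if i is inr t then - (t \in e j)%:R else 1.
pose b (i : 'I_1 + T) : rat := if i is inr t then - (z t)%:R else k%:R.
have [[y y_ge0 yP]|[x [x_ge0 xM xb]]] := farkas_ineq M b.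
  exists y; split=> // [i|].
    rewrite -lerN2 -sumrN big_mkcond; apply: le_trans (yP (inr i)).
    apply: ler_sum => j _ /=; rewrite mulNr.
    by case: (i \in e j); rewrite ?mul1r ?mul0r ?oppr0.
  by have := yP (inl ord0); rewrite (eq_bigr _ (fun j _ => mul1r (y j))).
have [N [m [N_gt0 mN]]] := clear_denominators x_ge0.
have NR : 0 < N%:R :> rat by rewrite ltr0n.
have [|s [sN s_stable sP]] :=
    @perfect_weighted_colouring _ G (fun t => m (inr t)) (m (inl ord0)) G_perf.
  move=> K /e_max[j /subsetP Kj]; rewrite -(ler_nat rat) mN natr_sum.
  under eq_bigr do rewrite mN.
  rewrite -mulr_sumr ler_pM2l //.
  have := xM j; rewrite big_sumType big_ord1 mulr1 /= addrC.
  under eq_bigr do rewrite mulrN.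
  rewrite sumrN addrC subr_ge0; apply: le_trans.
  rewrite [leRHS](bigID (mem K)) /= -[leLHS]addr0 lerD //.
    by apply: ler_sum => t tK; rewrite Kj // mulr1.
  by apply: sumr_ge0 => t _; rewrite mulr_ge0 // ler0n.
exfalso; move: xb; rewrite big_sumType big_ord1 /=.
under eq_bigr do rewrite mulrN.
rewrite sumrN subr_lt0 -(ltr_pM2l NR) mulrA -mN mulr_sumr.
under eq_bigr do rewrite mulrA -mN -natrM.
rewrite -natr_sum -natrM ltr_nat ltnNge => /negP; apply.
under eq_bigr do rewrite -sP -sum1_count big_mkcond big_distrl /=.
rewrite exchange_big /=.
apply: leq_trans (_ : \sum_(A <- s) k <= _)%N; last first.
  by rewrite big_const_seq count_predT iter_addn_0 mulnC leq_mul2r sN orbT.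
rewrite big_seq [leqRHS]big_seq; apply: leq_sum => A /(allP s_stable)/z_stable.
apply: leq_trans; rewrite [leqRHS]big_mkcond; apply: leq_sum => t _.
by case: (t \in A); rewrite ?mul1n.
Qed.

Section Decomposition.
Variables (T J : finType) (G : sgraph T) (e : J -> {set T}) (d : nat).
Hypothesis (G_perf : perfect G) (d_gt0 : (0 < d)%N).
Hypothesis e_clique : forall j, clique G (e j).
Hypothesis e_max : forall K, clique G K -> exists j, K \subset e j.
Hypothesis e_uniform : forall j, #|e j| = d.

Lemma sum_incidenceT (V : nmodType) (y : J -> V) :
  \sum_i \sum_(j | i \in e j) y j = (\sum_j y j) *+ d.
Proof.
have := sum_incidence e y setT; rewrite (eq_bigl predT) => [->|i];
  last by rewrite inE.
by rewrite -sumrMnl; apply: eq_bigr => j _; rewrite setIT e_uniform.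
Qed.

Lemma sum_stable_le (F : numDomainType) (y : J -> F) (S : {set T}) :
  (forall j, 0 <= y j) -> stable G S ->
  \sum_(i in S) \sum_(j | i \in e j) y j <= \sum_j y j.
Proof.
move=> y_ge0 S_stable; rewrite sum_incidence; apply: ler_sum => j _.
have := card_clique_stable (e_clique j) S_stable.
by case: #|_| => [|[]]// _; rewrite mulr0n.
Qed.

(** The fractional cover [y] of [z] has to be exact and of mass [k], by the
    first hypothesis. A stable set of weight [k] then meets every edge of
    positive mass exactly once, so removing one such edge from [z] lowers the weight of
    all these stable sets. *)
Lemma integral_decomposition (z : T -> nat) (k : nat) :
  (d * k <= \sum_i z i)%N ->
  (forall S, stable G S -> \sum_(i in S) z i <= k)%N ->
  exists c : J -> nat, forall i, z i = (\sum_(j | i \in e j) c j)%N.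
Proof.
elim: k => [|k IHk] in z * => z_large z_stable.
  exists (fun=> 0%N) => i; rewrite big1 //.
  apply/eqP; rewrite -leqn0 -(big_set1 addn i z).
  by apply: z_stable; exact: stable1.
have [y [y_ge0 yz yk]] := fractional_clique_cover G_perf e_max z_stable.
have le_sum : \sum_i (z i)%:R <= \sum_i \sum_(j | i \in e j) y j.
  by apply: ler_sum => i _.
have z_sum : (\sum_i z i)%:R = (\sum_j y j) *+ d.
  apply/le_anti; rewrite -sum_incidenceT natr_sum le_sum /=.
  rewrite sum_incidenceT -natr_sum; apply: le_trans (_ : (d * k.+1)%:R <= _).
    by rewrite mulnC natrM mulr_natr lerMn2r yk orbT.
  by rewrite ler_nat.
have y_sum : \sum_j y j = k.+1%:R.
  apply/le_anti; rewrite yk /=.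
  by rewrite -(ler_pMn2r d_gt0) -z_sum -mulrnA ler_nat mulnC.
have zE i : (z i)%:R = \sum_(j | i \in e j) y j.
  have /leif_sum[_] : forall i, true ->
      (z i)%:R <= \sum_(j | i \in e j) y j ?= iff
      ((z i)%:R == \sum_(j | i \in e j) y j).
    by move=> i0 _; split.
  rewrite sum_incidenceT -natr_sum z_sum eqxx => /esym/forallP/(_ i).
  by move/eqP.
have [j y_gt0] : exists j, 0 < y j.
  apply/existsP; rewrite -[X in is_true X]negbK; apply/negP => /existsPn y0.
  have : (0 : rat) < k.+1%:R by rewrite ltr0n.
  rewrite -y_sum big1 ?ltxx // => j _.
  by apply/le_anti; rewrite y_ge0 leNgt y0.
have z_gt0 i : i \in e j -> (0 < z i)%N.
  move=> ij; rewrite -(ltr_nat rat) zE (bigD1 j) //= ltr_pwDl //.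
  by apply: sumr_ge0.
pose z' i := (z i - (i \in e j))%N.
have z'E i : z i = (z' i + (i \in e j))%N.
  by rewrite subnK //; case: (boolP (i \in e j)) => // /z_gt0.
have z'_sum (S : {set T}) :
    (\sum_(i in S) z i = \sum_(i in S) z' i + #|e j :&: S|)%N.
  rewrite (eq_bigr _ (fun i _ => z'E i)) big_split /=; congr addn.
  rewrite -sum1_card [RHS](eq_bigl (fun i => (i \in S) && (i \in e j))).
    by rewrite [RHS]big_mkcondr; apply: eq_bigr => i _; case: (i \in e j).
  by move=> i; rewrite inE andbC.
have [||c cP] := IHk z'.
- have := z'_sum setT; rewrite setIT e_uniform.
  have sumT (f : T -> nat) : (\sum_(i in setT) f i = \sum_i f i)%N.
    by apply: eq_bigl => i; rewrite inE.
  by move: z_large; rewrite !sumT => + zE'; rewrite zE' mulnS addnC leq_add2r.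
- move=> S S_stable; rewrite -ltnS.
  have := z_stable S S_stable; rewrite leq_eqVlt => /orP[/eqP zS|]; last first.
    by apply: leq_trans; rewrite ltnS z'_sum leq_addr.
  rewrite -zS z'_sum -[X in (X < _)%N]addn0 ltn_add2l lt0n.
  apply: contraTneq y_gt0 => eS0; rewrite -leNgt.
  rewrite -(lerD2r (\sum_(i | i != j) y i)).
  have <- : \sum_i y i = y j + \sum_(i | i != j) y i by rewrite (bigD1 j).
  rewrite add0r y_sum -zS natr_sum (eq_bigr _ (fun i _ => zE i)).
  rewrite sum_incidence (bigD1 j) //= eS0 mulr0n add0r; apply: ler_sum => i _.
  have := card_clique_stable (e_clique i) S_stable.
  by case: #|_| => [|[]]// _; rewrite mulr0n.
exists (fun j' => c j' + (j' == j))%N => i.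
rewrite z'E cP big_split /=; congr addn.
rewrite [RHS]big_mkcond (bigD1 j) //= eqxx big1 ?addn0 => [|j' /negPf->].
  by case: (i \in e j).
by case: ifP.
Qed.
End Decomposition.

(** The real coefficients [y] serve to compare the sum of [z] with the largest
    weight [k] of a stable set: [k <= \sum_j y j] because an edge meets a stable
    set at most once. From there on, everything is rational. *)
Lemma cone_decomposition (F : numDomainType) (T J : finType) (G : sgraph T)
    (e : J -> {set T}) (d : nat) (z : T -> nat) (y : J -> F) :
  perfect G -> (0 < d)%N ->
  (forall j, clique G (e j)) ->
  (forall K, clique G K -> exists j, K \subset e j) ->
  (forall j, #|e j| = d) ->
  (forall j, 0 <= y j) ->
  (forall i, (z i)%:R = \sum_(j | i \in e j) y j) ->
  exists c : J -> nat, forall i, z i = (\sum_(j | i \in e j) c j)%N.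
Proof.
move=> G_perf d_gt0 e_clique e_max e_uniform y_ge0 zE.
pose k := (\max_(S : {set T} | stable G S) \sum_(i in S) z i)%N.
apply: (integral_decomposition (k := k) G_perf d_gt0 e_clique e_max e_uniform).
  have [|S S_stable kE] := @eq_bigmax_cond _ [pred S | stable G S]
      (fun S => \sum_(i in S) z i)%N.
    by apply/card_gt0P; exists set0; apply/stableP => x y'; rewrite inE.
  rewrite -(ler_nat F) [leRHS]natr_sum (eq_bigr _ (fun i _ => zE i)).
  rewrite (sum_incidenceT e_uniform) mulnC mulrnA lerMn2r; apply/orP; right.
  rewrite /k [X in X%:R <= _]kE natr_sum (eq_bigr _ (fun i _ => zE i)).
  exact: (sum_stable_le e_clique).
by move=> S S_stable; exact: leq_bigmax_cond.
Qed.

(** * Packing the edges of a uniform ideal clutter *)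

Definition vertex_cover (T J : finType) (e : J -> {set T}) (B : {set T}) :
    bool :=
  [forall j, e j :&: B != set0].

Lemma sum_vertex_cover_ge (F : numDomainType) (T J : finType)
    (e : J -> {set T}) (y : J -> F) (B : {set T}) :
  (forall j, 0 <= y j) -> vertex_cover e B ->
  \sum_j y j <= \sum_(i in B) \sum_(j | i \in e j) y j.
Proof.
move=> y_ge0 /forallP B_tr; rewrite sum_incidence; apply: ler_sum => j _.
by rewrite -[leLHS]mulr1n ler_wpMn2l // card_gt0.
Qed.

Definition edge (n : nat) (C : clutter 'I_n) (j : 'I_#|C|) : {set 'I_n} :=
  enum_val j.

(** A Farkas certificate against a packing of value [k] is, after scaling, a
    point [p] of the covering polyhedron with [w]-weight below [k]. A vertex of
    no larger weight is integral, as the clutter is ideal, and its support is a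
    vertex cover of weight below [k]. *)
Lemma ideal_fractional_packing (R : realType) (n : nat) (C : clutter 'I_n)
    (e := @edge n C) (w : 'I_n -> nat) (k : nat) :
  ideal R C ->
  (forall B, vertex_cover e B -> k <= \sum_(i in B) w i)%N ->
  exists y : 'I_#|C| -> R, [/\ forall j, 0 <= y j,
    forall i, \sum_(j | i \in e j) y j <= (w i)%:R & k%:R <= \sum_j y j].
Proof.
move=> C_ideal w_tr.
pose M (i : 'I_1 + 'I_n) (j : 'I_#|C|) : R :=
  if i is inr t then (t \in e j)%:R else -1.
pose b (i : 'I_1 + 'I_n) : R := if i is inr t then (w t)%:R else - k%:R.
have [[y y_ge0 yP]|[x [x_ge0 xM xb]]] := farkas_ineq M b.
  exists y; split=> // [i|].
    rewrite big_mkcond; apply: le_trans (yP (inr i)).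
    by apply: ler_sum => j _ /=; case: (i \in e j); rewrite ?mul1r ?mul0r.
  have := yP (inl ord0); rewrite /= (eq_bigr _ (fun j _ => mulN1r (y j))).
  by rewrite sumrN lerN2.
exfalso; pose t := x (inl ord0).
have {}xb : \sum_i x (inr i) * (w i)%:R < t * k%:R.
  by move: xb; rewrite big_sumType big_ord1 /= mulrN addrC subr_lt0.
have t_gt0 : 0 < t.
  rewrite lt_def x_ge0 andbT; apply: contraTneq xb => ->.
  by rewrite mul0r -leNgt; apply: sumr_ge0 => i _; rewrite mulr_ge0.
have {}xM j : t <= \sum_(i in e j) x (inr i).
  have := xM j; rewrite big_sumType big_ord1 /= mulrN mulr1 addrC subr_ge0.
  move/le_trans; apply; rewrite [leRHS]big_mkcond; apply: ler_sum => i _.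
  by case: (i \in e j); rewrite ?mulr1 ?mulr0.
pose A := clutter_matrix R C.
(* The positivity of [t] makes it possible to scale the certificate so
   that every edge has value at least 1. *)
pose p : 'rV[R]_n := \row_i (t^-1 * x (inr i)).
pose c : 'cV[R]_n := \col_i (w i)%:R.
pose B := row_mx 1%:M A : 'M[R]_(n, n + #|C|).
pose b' := row_mx 0 (const_mx 1) : 'rV[R]_(n + #|C|).
have BE (v : 'rV[R]_n) : v *m B = row_mx v (v *m A) by rewrite mul_mx_row mulmx1.
have AE (v : 'rV[R]_n) j : (v *m A) 0 j = \sum_(i in e j) v 0 i.
  rewrite mxE [RHS]big_mkcond; apply: eq_bigr => i _; rewrite !mxE.
  by case: ifP; rewrite ?mulr1 ?mulr0.
have QE v : polyhedron B b' v <-> covering_polyhedron A v.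
  rewrite /polyhedron BE; split=> [vP|[v_ge0 vA] j].
    split=> j; first by have := vP (lshift _ j); rewrite !row_mxEl mxE.
    by have := vP (rshift _ j); rewrite !row_mxEr mxE.
  by rewrite !mxE; case: (split j) => i; rewrite mxE.
have [|||v /(vertex_ext QE) v_vertex [/QE[v_ge0 vA] vc]] :=
    @exists_vertex_le _ _ _ B b' c p.
- apply/row_freeP; exists (col_mx 1%:M 0).
  by rewrite mul_row_col mulmx1 mulmx0 addr0.
- move=> h h_ge0; rewrite mxE; apply: sumr_ge0 => i _; rewrite [c _ _]mxE.
  by rewrite mulr_ge0 //; have := h_ge0 (lshift _ i); rewrite BE row_mxEl.
- apply/QE; split=> [i|j]; first by rewrite mxE mulr_ge0 ?invr_ge0 ?x_ge0.
  rewrite AE; under eq_bigr do rewrite mxE.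
  by rewrite -mulr_sumr mulrC ler_pdivlMr // mul1r.
have v_int := C_ideal v v_vertex.
have v_big i : v 0 i != 0 -> 1 <= v 0 i.
  move=> vi; have : 0 < v 0 i by rewrite lt_def vi v_ge0.
  by case/intrP: (v_int i) => m ->; rewrite ltr0z ler1z.
pose S := [set i | v 0 i != 0].
have S_tr : vertex_cover e S.
  apply/forallP => j; apply: contraTneq (vA j) => eS0.
  rewrite AE big1 -?ltNge ?ltr01 // => i ij.
  apply/eqP; apply: contraFT (in_set0 i) => vi; by rewrite -eS0 !inE ij vi.
have := w_tr S S_tr; rewrite leqNgt => /negP; apply.
rewrite -(ltr_nat R) natr_sum.
apply: le_lt_trans (_ : (v *m c) 0 0 < _).
  rewrite mxE big_mkcond; apply: ler_sum => i _; rewrite inE [c _ _]mxE.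
  case: ifPn => [/v_big vi|/negPn/eqP->]; last by rewrite mul0r.
  by rewrite ler_peMl.
apply: le_lt_trans vc _; rewrite mxE.
under eq_bigr do rewrite !mxE -mulrA.
by rewrite -mulr_sumr mulrC ltr_pdivrMr // mulrC.
Qed.

(** When no weight can be lowered, a vertex [i] with [0 < w i] lies on a vertex
    cover [B] of weight exactly [k]. The packing [y] has mass at least [k], and
    its load on [B] is at least its mass; so [y] saturates all vertices of [B],
    and [w] itself is a combination of edges. *)
Lemma integral_packing (F : numDomainType) (T J : finType) (e : J -> {set T})
    (d : nat) :
  (0 < d)%N -> (forall j, #|e j| = d) ->
  (forall (z : T -> nat) (y : J -> F), (forall j, 0 <= y j) ->
     (forall i, (z i)%:R = \sum_(j | i \in e j) y j) ->
     exists c : J -> nat, forall i, z i = (\sum_(j | i \in e j) c j)%N) ->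
  (forall (w : T -> nat) (k : nat),
     (forall B, vertex_cover e B -> k <= \sum_(i in B) w i)%N ->
     exists y : J -> F, [/\ forall j, 0 <= y j,
       forall i, \sum_(j | i \in e j) y j <= (w i)%:R & k%:R <= \sum_j y j]) ->
  forall (w : T -> nat) (k : nat),
    (forall B, vertex_cover e B -> k <= \sum_(i in B) w i)%N ->
    exists c : J -> nat,
      (forall i, \sum_(j | i \in e j) c j <= w i)%N /\ (k <= \sum_j c j)%N.
Proof.
move=> d_gt0 e_uniform cone_int frac w k.
move: {2}(\sum_i w i).+1 (ltnSn (\sum_i w i)) => m.
elim: m => // m IHm in w * => lt_w w_tr.
(* [w] lowered by one unit at [i]. *)
pose dec i x := (w x - (x == i))%N.
have [i /andP[wi /forall_inP dec_tr]|w_min] := pickP (fun i => (0 < w i)%N &&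
    [forall (B | vertex_cover e B), k <= \sum_(x in B) dec i x]%N).
  have [|//|c [c_le kc]] := IHm (dec i).
    apply: leq_trans (_ : (\sum_x w x <= m)%N) => //.
    rewrite (bigD1 i) //= [ltnRHS](bigD1 i) //= -addSn leq_add //.
      by rewrite /dec eqxx subn1 prednK.
    by apply: leq_sum => x _; exact: leq_subr.
  exists c; split=> // x; apply: leq_trans (c_le x) _; exact: leq_subr.
have [y [y_ge0 yw ky]] := frac w k w_tr.
have wE i : (w i)%:R = \sum_(j | i \in e j) y j.
  apply/eqP; rewrite eq_le yw andbT; case: (posnP (w i)) => [->|wi].
    exact: sumr_ge0.
  have := w_min i; rewrite wi /= => /negbT/forall_inPn[B B_tr].
  rewrite -ltnNge => dec_lt.
  have iB : i \in B.
    apply: contraTT dec_lt => iB; rewrite -leqNgt.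
    apply: leq_trans (w_tr B B_tr) _; apply: leq_sum => x xB.
    by rewrite /dec; case: eqP => [xi|_]; rewrite ?subn0 //; rewrite -xi xB in iB.
  have wB : (\sum_(x in B) w x)%:R <= k%:R :> F.
    rewrite ler_nat; apply: leq_trans dec_lt; rewrite (bigD1 i) //=.
    rewrite [X in (_ <= X.+1)%N](bigD1 i) //= -addSn leq_add //.
      by rewrite /dec eqxx subn1 prednK.
    apply: leq_sum => x /andP[_ /negPf xi]; by rewrite /dec xi subn0.
  have := le_trans ky (sum_vertex_cover_ge y_ge0 B_tr).
  move/(le_trans wB); rewrite natr_sum (bigD1 i) //= [leRHS](bigD1 i) //=.
  have le_rest : \sum_(x in B | x != i) \sum_(j | x \in e j) y j <=
      \sum_(x in B | x != i) (w x)%:R by apply: ler_sum.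
  by move=> le_all; rewrite -(lerD2r (\sum_(x in B | x != i) (w x)%:R));
    apply: le_trans le_all _; rewrite lerD2l.
have [c cP] := cone_int w y y_ge0 wE.
exists c; split=> [i|]; first by rewrite -cP.
rewrite -(leq_pmul2r d_gt0) -(ler_nat F).
have cd : (\sum_i w i = (\sum_j c j) * d)%N.
  rewrite (eq_bigr _ (fun i _ => cP i)).
  apply/eqP; rewrite -(eqr_nat F) natr_sum natrM mulr_natr natr_sum.
  rewrite -(sum_incidenceT e_uniform).
  by apply/eqP; apply: eq_bigr => i _; rewrite natr_sum.
rewrite -cd natr_sum (eq_bigr _ (fun i _ => wE i)) (sum_incidenceT e_uniform).
by rewrite mulrnA lerMn2r ky orbT.
Qed.

(** * The clique clutter *)

Lemma nat_span_real_cone (R : realType) (m q : nat) (h : 'I_q -> 'cV[int]_m)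
    (z : 'cV[int]_m) :
  nat_span h z -> real_cone h (map_mx (intr : int -> R) z).
Proof.
case=> c ->; exists (fun j => (c j)%:R); split=> [j|]; first exact: ler0n.
rewrite raddf_sum; apply: eq_bigr => j _.
by rewrite raddfMn scaler_nat.
Qed.

Lemma real_cone_edge_vec (R : realType) (n : nat) (C : clutter 'I_n)
    (c : 'I_#|C| -> R) (z : 'cV[R]_n) :
  z = \sum_j c j *: map_mx intr (edge_vec j) ->
  forall i, z i 0 = \sum_(j | i \in edge j) c j.
Proof.
move=> -> i; rewrite summxE [RHS]big_mkcond; apply: eq_bigr => j _.
by rewrite !mxE; case: ifP; rewrite ?mulr1 ?mulr0.
Qed.

Section CliqueClutter.
Variables (R : realType) (n : nat) (G : sgraph 'I_n).
Hypotheses (n_gt0 : (0 < n)%N) (G_perfect : perfect G).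
Hypothesis C_uniform : uniform (clique_clutter G).
Let C := clique_clutter G.
Let e := @edge n C.

Lemma edge_clique j : clique G (e j).
Proof. by have := enum_valP j; rewrite inE => /maxsetp. Qed.

Lemma clique_sub_edge K : clique G K -> exists j, K \subset e j.
Proof.
case/maxset_exists=> A A_max KA; have AC : A \in C by rewrite inE.
by exists (enum_rank_in AC A); rewrite /e /edge enum_rankK_in.
Qed.

Lemma edge_card : exists2 d, (0 < d)%N & forall j, #|e j| = d.
Proof.
have clique1 : clique G [set Ordinal n_gt0].
  by apply/cliqueP => x y /set1P-> /set1P->; rewrite eqxx.
have [j0 /subsetP je] := clique_sub_edge clique1.
exists #|e j0| => [|j]; last exact: C_uniform (enum_valP j) (enum_valP j0).
by apply/card_gt0P; exists (Ordinal n_gt0); apply/je/set11.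
Qed.

Lemma clique_clutter_decomposition (z : 'I_n -> nat) (y : 'I_#|C| -> R) :
  (forall j, 0 <= y j) -> (forall i, (z i)%:R = \sum_(j | i \in e j) y j) ->
  exists c : 'I_#|C| -> nat, forall i, z i = (\sum_(j | i \in e j) c j)%N.
Proof.
have [d d_gt0 e_uniform] := edge_card.
exact: (cone_decomposition G_perfect d_gt0 edge_clique clique_sub_edge).
Qed.

Lemma clique_clutter_hilbert : hilbert_basis R (edge_vec (C := C)).
Proof.
move=> z; split; first exact: nat_span_real_cone.
case=> y [y_ge0 /real_cone_edge_vec zE].
have z_ge0 i : 0 <= z i 0.
  rewrite -(ler0z R); have := zE i; rewrite mxE => ->; exact: sumr_ge0.
have [|c cP] := @clique_clutter_decomposition (fun i => `|(z i 0)%R|%N) y y_ge0.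
  by move=> i; rewrite natr_absz ger0_norm // -zE mxE.
exists c; apply/colP => i; rewrite summxE -[LHS]gez0_abs // cP.
rewrite -natz natr_sum big_mkcond; apply: eq_bigr => j _.
by rewrite !mulmxnE !mxE /e /edge; case: ifP => _; rewrite ?mul0rn // natz.
Qed.

(** Lifting a decomposition of the first [n] coordinates works because the
    number of edges used is the sum of these coordinates divided by [d]. *)
Lemma clique_clutter_ehrhart : ehrhart R C.
Proof.
move=> z; split; first exact: nat_span_real_cone.
case=> y [y_ge0 zE].
have zuE : map_mx intr (usubmx z) =
    \sum_j y j *: map_mx (intr : int -> R) (edge_vec j).
  rewrite map_usubmx zE raddf_sum; apply: eq_bigr => j _.
  by rewrite map_col_mx scale_col_mx /= col_mxKu.
have zdE : (dsubmx z 0 0)%:~R = \sum_j y j :> R.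
  have -> : (dsubmx z 0 0)%:~R = (dsubmx (map_mx intr z)) 0 0 :> R.
    by rewrite !mxE.
  rewrite zE raddf_sum summxE; apply: eq_bigr => j _.
  by rewrite map_col_mx scale_col_mx /= col_mxKd !mxE mulr1.
have [|c zuc] := (clique_clutter_hilbert (usubmx z)).2; first by exists y.
exists c; rewrite -[LHS]vsubmxK.
have [d d_gt0 e_uniform] := edge_card.
have zdc : dsubmx z 0 0 = \sum_j 1 *+ c j.
  apply/eqP; rewrite -(eqr_int R) zdE rmorph_sum /= -(eqr_pMn2r d_gt0).
  rewrite -!(sum_incidenceT e_uniform); apply/eqP/eq_bigr => i _.
  rewrite -(real_cone_edge_vec zuE) zuc mxE summxE rmorph_sum [RHS]big_mkcond.
  apply: eq_bigr => j _; rewrite mulmxnE !mxE /e /edge.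
  by case: ifP => _; rewrite ?mul0rn.
apply/colP => i; rewrite mxE summxE.
case: split_ordP => k ->.
  rewrite zuc summxE; apply: eq_bigr => j _.
  by rewrite !mulmxnE col_mxEu.
rewrite ord1 zdc; apply: eq_bigr => j _.
by rewrite mulmxnE col_mxEd mxE.
Qed.

Lemma clique_clutter_mfmc : ideal R C -> mfmc R C.
Proof.
move=> C_ideal w; have [d d_gt0 e_uniform] := edge_card.
have setT_tr : vertex_cover e setT.
  by apply/forallP => j; rewrite setIT -card_gt0 e_uniform.
have [B B_tr B_min] := @arg_minnP _ setT (vertex_cover e)
  (fun B => \sum_(i in B) w i 0%R)%N setT_tr.
have [c [c_le c_ge]] := integral_packing d_gt0 e_uniform
   clique_clutter_decomposition
   (fun w k => @ideal_fractional_packing R n C w k C_ideal) B_min.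
have AE (y : 'cV[R]_#|C|) i :
    (clutter_matrix R C *m y) i 0 = \sum_(j | i \in e j) y j 0.
  rewrite mxE [RHS]big_mkcond; apply: eq_bigr => j _; rewrite !mxE.
  by case: ifP; rewrite ?mul1r ?mul0r.
exists (\col_j (c j)%:R); split.
- split=> [j|i]; first by rewrite mxE ler0n.
  rewrite AE; under eq_bigr do rewrite mxE.
  by rewrite -natr_sum ler_nat.
- by move=> j; rewrite mxE natr_int.
move=> y [y_ge0 yw]; apply: le_trans (sum_vertex_cover_ge y_ge0 B_tr) _.
apply: le_trans (_ : (\sum_(i in B) w i 0%R)%N%:R <= _).
  by rewrite natr_sum; apply: ler_sum => i _; rewrite -AE.
by under [leRHS]eq_bigr do rewrite mxE; rewrite -natr_sum ler_nat.
Qed.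

End CliqueClutter.

Theorem theorem3p8 (R : realType) (n : nat) (G : sgraph 'I_n)
    (n_gt0 : (0 < n)%N)
    (G_perfect : perfect G)
    (G_no_isolated : no_isolated G)
    (C_ideal : ideal R (clique_clutter G))
    (C_uniform : uniform (clique_clutter G)) :
  hilbert_basis R (edge_vec (C := clique_clutter G)) /\
  ehrhart R (clique_clutter G) /\
  mfmc R (clique_clutter G).
Proof.
split; first exact: clique_clutter_hilbert.
split; first exact: clique_clutter_ehrhart.
exact: clique_clutter_mfmc.
Qed.
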